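(* Let $n\ge 1$ and let $\Lambda$ be a set of partitions of $n$ which, for each $1\le k\le n$, contains at most one partition with first row of length $k$. Then the sequence $\ell_{n,1}^\Lambda,\dots,\ell_{n,n}^\Lambda$ is log concave if and only if the sequence $i_{n,1}^\Lambda,\dots,i_{n,n}^\Lambda$ is log concave.
   Context: $\mathfrak S_n$ is the set of permutations of $[n]=\{1,\dots,n\}$. For $\pi\in\mathfrak S_n$, $\ell(\pi)$ is the length of a longest increasing subsequence of $\pi$ (in one-line notation). The shape $\operatorname{sh}\pi$ is the common shape (a partition of $n$) of the two standard Young tableaux associated with $\pi$ by the Robinson–Schensted correspondence. For a set $\Lambda$ of partitions of $n$, $\ell_{n,k}^\Lambda$ is the number of $\pi\in\mathfrak S_n$ with $\ell(\pi)=k$ and $\operatorname{sh}\pi\in\Lambda$, and $i_{n,k}^\Lambda$ is the number of involutions $\pi\in\mathfrak S_n$ (permutations whose square is the identity) with $\ell(\pi)=k$ and $\operatorname{sh}\pi\in\Lambda$. A sequence of real numbers $l_1,\dots,l_n$ is log concave if $l_{k-1}l_{k+1}\le l_k^2$ for all $1\le k\le n$, with the convention $l_0=l_{n+1}=0$. *)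

(* Defs.v *)
From mathcomp Require Import all_boot all_order all_fingroup all_algebra.

Set Implicit Arguments.
Unset Strict Implicit.
Unset Printing Implicit Defensive.

Import Order.TTheory GRing.Theory Num.Theory.

Definition intpartn (n : nat) : {pred seq nat} :=
  [pred la : seq nat | [&& sorted geq la, 0 \notin la & sumn la == n]].

(* 'S_n permutes {0, ..., n-1}; values are shifted so that the word is in the
   letters 1, ..., n. *)
Definition one_line (n : nat) (s : 'S_n) : seq nat :=
  [seq (val (s i)).+1 | i <- enum 'I_n].

(* A subsequence of w is mask m w for a selection m of positions of w. *)
Definition lis (w : seq nat) : nat :=
  \max_(m : (size w).-tuple bool | sorted ltn (mask m w)) size (mask m w).

(* Schensted row insertion: x replaces the leftmost entry of r larger than x,
   which is returned as Some y; if there is none, x is appended to r. *)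
Fixpoint row_insert (x : nat) (r : seq nat) : option nat * seq nat :=
  if r is y :: r' then
    if x < y then (Some y, x :: r')
    else let: (b, r'') := row_insert x r' in (b, y :: r'')
  else (None, [:: x]).

(* Tableaux are sequences of rows, the longest row first. Returns the tableau
   after insertion and the index of the row in which the new cell appears. *)
Fixpoint tab_insert (x : nat) (t : seq (seq nat)) : seq (seq nat) * nat :=
  if t is r :: t' then
    let: (b, r') := row_insert x r in
    if b is Some y then
      let: (t'', i) := tab_insert y t' in (r' :: t'', i.+1)
    else (r' :: t', 0)
  else ([:: [:: x]], 0).

Definition tab_add (t : seq (seq nat)) (i k : nat) : seq (seq nat) :=
  set_nth [::] t i (rcons (nth [::] t i) k).

Definition RS_step (PQ : seq (seq nat) * seq (seq nat)) (kx : nat * nat) :=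
  let: (P, i) := tab_insert kx.2 PQ.1 in (P, tab_add PQ.2 i kx.1).

(* The pair (insertion tableau, recording tableau); the k-th letter, k >= 1, is
   recorded by the entry k. *)
Definition RS (w : seq nat) : seq (seq nat) * seq (seq nat) :=
  foldl RS_step ([::], [::]) (zip (iota 1 (size w)) w).

Definition sh (n : nat) (s : 'S_n) : seq nat := shape (RS (one_line s)).1.

Lemma shape_tab_insert x P Q : shape P = shape Q ->
  forall k, shape (tab_insert x P).1 = shape (tab_add Q (tab_insert x P).2 k).
Proof.
elim: P Q x => [|r P IH] [|q Q] x //= [hq hs] k.
have szr z : size (row_insert z r).2 =
    if (row_insert z r).1 is Some _ then size r else (size r).+1.
  elim: r {hq} => //= y r IHr; case: ifP => //= _.
  by case: (row_insert z r) IHr => [[b|] r'] /= ->.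
case: (row_insert x r) (szr x) => [[y|] r'] /= szr'.
- case E: (tab_insert y P) => [t i] /=.
  have := IH Q y hs k; rewrite E /= => ->.
  by rewrite szr' hq.
- by rewrite /tab_add /= size_rcons szr' hq hs.
Qed.

Lemma shape_RS w : shape (RS w).1 = shape (RS w).2.
Proof.
rewrite /RS; set s := zip _ _; elim/last_ind: s => // s [k x] IH.
rewrite -cats1 foldl_cat /= {1 3}/RS_step.
have := shape_tab_insert x IH k.
by rewrite /=; case: (tab_insert _ _).
Qed.

Definition ell (n : nat) (Lambda : {pred seq nat}) (k : nat) : nat :=
  #|[set s : 'S_n | (lis (one_line s) == k) && (sh s \in Lambda)]|.

Definition invol (n : nat) (Lambda : {pred seq nat}) (k : nat) : nat :=
  #|[set s : 'S_n | [&& (s * s == 1)%g, lis (one_line s) == k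
                      & sh s \in Lambda]]|.

Local Open Scope ring_scope.

Section LogConcave.

Variables (R : realFieldType) (n : nat) (l : nat -> R).

(* The terms l 1, ..., l n extended by 0, regardless of the other values of l. *)
Definition pad0 (k : nat) : R := if (1 <= k <= n)%N then l k else 0.

Definition log_concave : Prop :=
  forall k : nat, (1 <= k <= n)%N ->
    pad0 k.-1 * pad0 k.+1 <= pad0 k ^+ 2.

End LogConcave.

(* Main.v *)
(* By Schensted's theorem and the hypothesis on Lambda, the permutations counted
   by ell n Lambda k are none at all, or exactly those of one shape la; those
   counted by invol n Lambda k are then the involutions among them.  The
   Robinson-Schensted correspondence identifies the permutations of shape la
   with pairs (P, Q) of standard tableaux of shape la; inversion swaps P and Q,
   so involutions correspond to P = Q.  Hence ell = invol ^ 2 termwise, and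
   squaring nonnegative terms preserves and reflects log concavity.

   Q is never used itself: the sequence of shapes of the insertion tableaux of
   the prefixes of the word carries the same information.  Inversion symmetry
   comes from growth diagrams: the shapes of the subwords cut out by bounding
   positions by i and values by j obey a local rule that is symmetric under
   exchanging i and j. *)
Require Import Defs.
From mathcomp Require Import all_boot all_order all_fingroup all_algebra zify.

Set Implicit Arguments.
Unset Strict Implicit.
Unset Printing Implicit Defensive.

Import Order.TTheory GRing.Theory Num.Theory.

(** * Row insertion and its injectivity *)

Definition ins (w : seq nat) : seq (seq nat) :=
  foldl (fun t x => (tab_insert x t).1) [::] w.

(** Strictness down the columns includes that the lower row is no longer than the upper one, so
    [ssyt] also forces a partition shape. *)
Definition col_lt (r s : seq nat) : Prop :=
  forall i, i < size s -> (i < size r) && (nth 0 r i < nth 0 s i).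

(* Rows need only increase weakly: distinct entries are never required for
   reversing insertion. *)
Fixpoint ssyt (t : seq (seq nat)) : Prop :=
  if t is r :: t' then
    [/\ r != [::], sorted leq r, col_lt r (head [::] t') & ssyt t']
  else True.

Lemma ins_rcons w x : ins (rcons w x) = (tab_insert x (ins w)).1.
Proof. by rewrite /ins foldl_rcons. Qed.

Lemma RS_ins w : (RS w).1 = ins w.
Proof.
rewrite /RS /ins.
have -> : forall k PQ, (foldl RS_step PQ (zip (iota k (size w)) w)).1 =
   foldl (fun t x => (tab_insert x t).1) PQ.1 w; last by [].
elim: w => //= x w IH k PQ.
by rewrite IH /RS_step /=; case: tab_insert.
Qed.

(** When nothing exceeds [x], [p] is [size r]: [onth] then gives [None] and [set_nth] appends, so
    one formula covers both cases. *)
Lemma row_insertE x r (p := find (ltn x) r) :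
  row_insert x r = (onth r p, set_nth 0 r p x).
Proof.
rewrite {}/p; elim: r => //= y r ->.
by rewrite /ltn /=; case: ifP.
Qed.

Lemma onth_SomeE (r : seq nat) p y :
  onth r p = Some y -> p < size r /\ y = nth 0 r p.
Proof.
move=> E; split; last by rewrite (onth_nth 0 _ _ _ E).
by rewrite ltnNge; apply/negP => h; rewrite onth_default in E.
Qed.

Lemma row_insert_None x r : (row_insert x r).1 = None ->
  (row_insert x r).2 = rcons r x.
Proof.
elim: r => //= y r IH; case: ltnP => // _.
by case: row_insert IH => [[z|] r'] //= IH _; rewrite IH.
Qed.

Lemma sorted_leq_nth0 r i j :
  sorted leq r -> i <= j -> j < size r -> nth 0 r i <= nth 0 r j.
Proof.
move=> sr ij jr.
by apply: (sorted_leq_nth leq_trans leqnn 0 sr); rewrite ?inE ?(leq_ltn_trans ij).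
Qed.

Lemma sorted_row_insert x r : sorted leq r -> sorted leq (row_insert x r).2.
Proof.
move=> sr; rewrite row_insertE /=; set p := find _ _.
have pr : p <= size r by exact: find_size.
apply/(sortedP 0) => i; rewrite size_set_nth !nth_set_nth /= => hi.
have [Ei|ni] := eqVneq i p.
  have -> : (i.+1 == p) = false by lia.
  have /(nth_find 0) : has (ltn x) r by rewrite has_find -/p; lia.
  rewrite -/p /= => h; apply: (leq_trans (ltnW h)).
  by apply: sorted_leq_nth0 => //; lia.
case: eqVneq => [Ep|np].
  by have /negbT := before_find 0 (a := ltn x) (s := r) (i := i) ltac:(lia);
    rewrite /= -leqNgt.
by apply: sorted_leq_nth0 => //; lia.
Qed.

(** Below [y] in its old column [p] stands a larger entry or nothing, so [y] lands in a column
    [q <= p] of the lower row. Above it is then [x] itself or an entry left of [p], hence at most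
    [x < y]. *)
Lemma col_lt_insert x y r s : sorted leq r -> col_lt r s ->
  (row_insert x r).1 = Some y ->
  col_lt (row_insert x r).2 (row_insert y s).2.
Proof.
move=> sr rs; rewrite !row_insertE /=; set p := find _ r; set q := find _ s => Ey.
have [pr {}Ey] := onth_SomeE Ey.
have hp : x < y.
  by have := nth_find 0 (a := ltn x) (s := r); rewrite has_find -/p pr /= Ey => ->.
have qp : q <= p.
  rewrite leqNgt; apply/negP => lt.
  have := before_find 0 lt; have := find_size (ltn y) s; rewrite -/q => hq.
  have /andP[_] := rs p ltac:(lia).
  by rewrite -Ey /= => ->.
have qs := find_size (ltn y) s; rewrite -/q in qs.
move=> i; rewrite !size_set_nth !nth_set_nth /= => hi.
case: (eqVneq i q) => [->|nq].
  case: eqVneq => [_|np]; first by rewrite hp andbT; lia.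
  have qp' : q < p by lia.
  apply/andP; split; first lia.
  have := before_find 0 qp' => /= /negbT; lia.
have /andP[h1 h2] := rs i ltac:(lia).
case: eqVneq => [Ei|_]; last by rewrite h2 andbT; lia.
rewrite Ei in h2 *; apply/andP; split; first lia.
by apply: leq_ltn_trans h2; rewrite -Ey ltnW.
Qed.

Lemma head_tab_insert x t :
  head [::] (tab_insert x t).1 = (row_insert x (head [::] t)).2.
Proof.
case: t => //= r t; case: row_insert => [[y|] r'] //=.
by case: tab_insert.
Qed.

Lemma ssyt_insert x t : ssyt t -> ssyt (tab_insert x t).1.
Proof.
elim: t x => [|r t IH] x /=; first by split=> //; case.
case=> rn sr rt st.
have := sorted_row_insert x sr; have := @col_lt_insert x _ r (head [::] t) sr rt.
have : (row_insert x r).2 != [::].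
  rewrite row_insertE /= -size_eq0 size_set_nth; lia.
have := @row_insert_None x r.
case: (row_insert x r) => [[y|] r'] /= E nr' h sr'.
  have := head_tab_insert y t; have := IH y st.
  by case: tab_insert => t' i /= ? Eh; split=> //; rewrite Eh; apply: h.
split=> //; rewrite E // => i /rt /andP[h1 h2].
by rewrite size_rcons nth_rcons h1 h2 leqW.
Qed.

Lemma ssyt_ins w : ssyt (ins w).
Proof. by elim/last_ind: w => // w x IH; rewrite ins_rcons; apply: ssyt_insert. Qed.

(* Reverse bumping: x replaced y at the last entry of the new row below y. *)
Lemma row_insert_Some_inv x y r r' : sorted leq r ->
  row_insert x r = (Some y, r') ->
  let p := (find (leq y) r').-1 in x = nth 0 r' p /\ r = set_nth 0 r' p y.
Proof.
move=> sr; rewrite row_insertE; set p := find _ _ => -[Ey Er].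
have [pr {}Ey] := onth_SomeE Ey.
have hp : x < y.
  by have := nth_find 0 (a := ltn x) (s := r); rewrite has_find -/p pr /= Ey => ->.
have sz : size r' = size r by rewrite -Er size_set_nth; lia.
(* Up to [p] the entries of [r'] are at most [x < y]; right of [p] they are at least [y], since [r]
   is sorted. *)
have Ef : find (leq y) r' = p.+1.
  apply/eqP; rewrite eqn_leq; apply/andP; split.
    rewrite leqNgt; apply/negP => lt.
    have := before_find 0 lt; have := find_size (leq y) r' => hs.
    rewrite -Er nth_set_nth /= ifF; last lia.
    by rewrite Ey sorted_leq_nth0 //; lia.
  rewrite ltnNge; apply/negP => le.
  have hf : has (leq y) r' by rewrite has_find; lia.
  have := nth_find 0 hf; rewrite -Er nth_set_nth /= Er.
  case: eqVneq => [_|np]; first lia.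
  have := before_find 0 (a := ltn x) (s := r) (i := find (leq y) r') ltac:(lia).
  by move=> /= /negbT; lia.
rewrite /= Ef /=; split; first by rewrite -Er nth_set_nth /= eqxx.
apply: (@eq_from_nth _ 0); first by rewrite -Er !size_set_nth; lia.
move=> i hi; rewrite -Er !nth_set_nth /= nth_set_nth /=.
by case: eqVneq => // ->.
Qed.

(** The returned row index tells where bumping stopped, hence where reverse bumping starts. Nonempty
    rows separate insertion into the empty tableau from appending to an empty row. *)
Lemma tab_insert_inj x1 x2 t1 t2 : ssyt t1 -> ssyt t2 ->
  tab_insert x1 t1 = tab_insert x2 t2 -> x1 = x2 /\ t1 = t2.
Proof.
elim: t1 t2 x1 x2 => [|r1 t1 IH] [|r2 t2] x1 x2 //=.
- by move=> _ _ [->].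
- move=> _ [n2 s2 _ _]; have := @row_insert_None x2 r2.
  case: row_insert => [[y2|] r2'] /=; first by case: tab_insert.
  by move=> -> // [E]; case: r2 E n2 {s2} => //= ? [].
- move=> [n1 s1 _ _] _; have := @row_insert_None x1 r1.
  case: row_insert => [[y1|] r1'] /=; first by case: tab_insert.
  by move=> -> // [E]; case: r1 E n1 {s1} => //= ? [].
move=> [n1 s1 _ st1] [n2 s2 _ st2].
have := @row_insert_None x1 r1; have := @row_insert_None x2 r2.
case E1: (row_insert x1 r1) => [[y1|] r1'];
 case E2: (row_insert x2 r2) => [[y2|] r2'] /=.
- move=> _ _.
  case T1: (tab_insert y1 t1) => [t1' i1]; case T2: (tab_insert y2 t2) => [t2' i2].
  case=> Er Et Ei; subst.
  have [//|//||Ey ->] := IH t2 y1 y2; first by rewrite T1 T2.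
  subst.
  have [/= -> ->] := row_insert_Some_inv s1 E1.
  by have [/= -> ->] := row_insert_Some_inv s2 E2.
- by case: tab_insert.
- by case: tab_insert.
by move=> -> // -> // [/rcons_inj [-> ->] ->].
Qed.

Lemma shape_tab_add t a m : shape (tab_add t a m) = incr_nth (shape t) a.
Proof.
elim: t a => [|r t IH] [|a] //=.
- by congr (0 :: _); elim: a => //= a ->.
- by rewrite size_rcons.
by rewrite -IH.
Qed.

Lemma shape_insert x t :
  shape (tab_insert x t).1 = incr_nth (shape t) (tab_insert x t).2.
Proof. by rewrite (shape_tab_insert x (erefl (shape t)) 0) shape_tab_add. Qed.

(** Two consecutive prefix shapes determine the row index that [tab_insert_inj] asks for, so the
    last letters agree and can be removed. *)
Lemma ins_inj w1 w2 : ins w1 = ins w2 -> size w1 = size w2 ->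
  (forall k, k <= size w1 ->
     shape (ins (take k w1)) = shape (ins (take k w2))) -> w1 = w2.
Proof.
elim/last_ind: w1 w2 => [|w1 x1 IH] w2; first by case: w2.
case/lastP: w2 => [|w2 x2]; rewrite !size_rcons // => E [Es] H.
have Hk k : k <= size w1 -> shape (ins (take k w1)) = shape (ins (take k w2)).
  by move=> hk; have := H k (leqW hk); rewrite -!cats1 !takel_cat // -Es.
have := Hk _ (leqnn _); rewrite {2}Es !take_size => Em.
move: (E); rewrite !ins_rcons => E'.
have Ei : (tab_insert x1 (ins w1)).2 = (tab_insert x2 (ins w2)).2.
  apply: (@incr_nth_inj (shape (ins w1))).
  by rewrite -shape_insert Em -shape_insert E'.
have : tab_insert x1 (ins w1) = tab_insert x2 (ins w2).
  by move: E' Ei; do 2 case: tab_insert => ? ? /=; move=> -> ->.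
case/tab_insert_inj; try exact: ssyt_ins.
by move=> -> /IH -> //.
Qed.

(** * Reverse insertion *)

Lemma col_lt_size r s : col_lt r s -> size s <= size r.
Proof. by case: s => // a s /(_ (size s) (ltnSn _)) /andP[]. Qed.

Lemma size_head (t : seq (seq nat)) : size (head [::] t) = head 0 (shape t).
Proof. by case: t. Qed.

Lemma row_insert_last x r : all (geq x) r -> row_insert x r = (None, rcons r x).
Proof.
by elim: r => //= y r IH /andP[yx /IH ->]; rewrite ltnNge yx.
Qed.

(** Reverse bumping: [x] is the last entry of [r] less than [y], and [r'] puts [y] back in its
    place. *)
Lemma row_insert_surj y r s : sorted leq r -> sorted leq s ->
  col_lt r (row_insert y s).2 ->
  exists x r', [/\ r' != [::], sorted leq r', col_lt r' s
                 & row_insert x r' = (Some y, r)].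
Proof.
move=> sr ss; rewrite row_insertE /=; set q := find _ s => rs.
have qs : q <= size s by exact: find_size.
have /andP[qr] := rs q ltac:(rewrite size_set_nth; lia).
rewrite nth_set_nth /= eqxx => ry.
(* In the inserted lower row [y] stands in column [q], so the entry of [r] above it is less than
   [y]. Hence [p] below is a real position with [q <= p]. *)
have qf : q < find (leq y) r.
  rewrite ltnNge; apply/negP => h.
  have hf : has (leq y) r by rewrite has_find; lia.
  have := nth_find 0 hf => /= h1.
  by have := sorted_leq_nth0 sr h qr; lia.
set p := (find (leq y) r).-1.
have fs := find_size (leq y) r.
have rp : nth 0 r p < y.
  by have := before_find 0 (a := leq y) (s := r) (i := p) ltac:(lia) => /= /negbT; lia.
have rp' k : p < k -> k < size r -> y <= nth 0 r k.
  move=> pk kr; have hf : has (leq y) r by rewrite has_find; lia.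
  have := nth_find 0 hf => /= h1; apply: (leq_trans h1).
  by apply: sorted_leq_nth0 => //; lia.
exists (nth 0 r p), (set_nth 0 r p y); split.
- by rewrite -size_eq0 size_set_nth; lia.
- apply/(sortedP 0) => i; rewrite size_set_nth !nth_set_nth /= => hi.
  case: eqVneq => [Ei|ni]; first by rewrite ifF; [apply: rp'|]; lia.
  case: eqVneq => [Ei|ni'].
    by apply: leq_trans (ltnW rp); apply: sorted_leq_nth0 => //; lia.
  by apply: sorted_leq_nth0 => //; lia.
- move=> i hi; rewrite size_set_nth nth_set_nth /=.
  have /andP[h1 h2] := rs i ltac:(rewrite size_set_nth; lia).
  move: h2; rewrite nth_set_nth /=.
  have yq : q < size s -> y < nth 0 s q.
    by move=> qs'; have := nth_find 0 (a := ltn y) (s := s); rewrite has_find qs'; apply.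
  case: (eqVneq i q) => [Ei|nq]; case: (eqVneq i p) => [Ep|np].
  + by rewrite Ei yq //; lia.
  + by rewrite Ei => h; have := yq ltac:(lia); lia.
  + move=> _; apply/andP; split; first lia.
    have hq : q < size s by lia.
    by apply: leq_trans (yq hq) _; apply: sorted_leq_nth0 => //; lia.
  + by move=> ->; lia.
rewrite row_insertE; set f := find _ _.
have -> : f = p.
  apply/eqP; rewrite eqn_leq; apply/andP; split.
    rewrite leqNgt; apply/negP => lt.
    by have := before_find 0 lt; rewrite nth_set_nth /= eqxx; lia.
  rewrite leqNgt; apply/negP => lt.
  have hf : has (ltn (nth 0 r p)) (set_nth 0 r p y).
    by rewrite has_find -/f size_set_nth; lia.
  have := nth_find 0 hf; rewrite -/f nth_set_nth /= ifF; last lia.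
  by have := sorted_leq_nth0 sr (ltnW lt) ltac:(lia); lia.
congr pair.
  have : nth 0 (set_nth 0 r p y) p = y by rewrite nth_set_nth /= eqxx.
  rewrite -(odflt_onth 0); have := onthTE (set_nth 0 r p y) p.
  have -> : p < size (set_nth 0 r p y) by rewrite size_set_nth; lia.
  by case: onth => //= a _ ->.
apply: (@eq_from_nth _ 0); first by rewrite !size_set_nth; lia.
move=> i; rewrite !nth_set_nth /= nth_set_nth /=.
by case: eqVneq => // ->.
Qed.

(** The cell at the end of row [i] is removed. For row 0 its entry is the inserted letter; otherwise
    the insertion below the first row is reversed, and the letter so obtained is bumped back through
    that row. *)
Lemma tab_insert_surj T t i : ssyt T -> ssyt t ->
  shape T = incr_nth (shape t) i ->
  exists x T', [/\ ssyt T', shape T' = shape t & tab_insert x T' = (T, i)].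
Proof.
elim: T t i => [|r T IH] [|r0 t] [|i] //=.
- case: r => [|x [|y r]] [] //= _ _ _ _ _ [E].
  by exists x, [::]; case: T E {IH} => //.
- by case: r => // [[]].
- case/lastP: r => [[] //|r x] [_ sr rT sT] [rn0 _ rt0 _] [].
  rewrite size_rcons => -[sz] E.
  have hx : all (geq x) r.
    move: sr; rewrite -cats1 (sorted_pairwise leq_trans) pairwise_cat.
    by case/and3P; rewrite allrel1r.
  exists x, (r :: T); split=> /=.
  + split=> //; first by rewrite -size_eq0 sz size_eq0.
      move: sr; rewrite -cats1 (sorted_pairwise leq_trans) pairwise_cat.
      by case/and3P=> _; rewrite -(sorted_pairwise leq_trans).
    move=> k hk; have /andP[_] := rT k hk.
    (* The shape of [t] bounds the second row by the shortened first row. *)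
    have kr : k < size r.
      by rewrite sz; apply: leq_trans (col_lt_size rt0); move: hk; rewrite !size_head E.
    by rewrite nth_rcons kr.
  + by rewrite sz E.
  by rewrite row_insert_last.
case=> rn sr rT sT [rn0 _ rt0 st0] [sz E].
have [y [T' [sT' ET' EI]]] := IH t i sT st0 E.
have Eh := head_tab_insert y T'; rewrite EI /= in Eh; rewrite Eh in rT.
have sh' : sorted leq (head [::] T') by case: (T') sT' => //= ? ? [].
have [x [r' [n' sr' rT' Er]]] := row_insert_surj sr sh' rT.
exists x, (r' :: T'); split=> //=; last by rewrite Er EI.
rewrite ET' -sz; congr (_ :: _).
have := row_insertE x r'; rewrite Er => -[+ ->] => /esym/onth_SomeE[h _].
by rewrite size_set_nth; lia.
Qed.

(** Insertions are undone from [T], the prefix shapes of [w] choosing the cell to remove each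
    time. *)
Lemma ins_surj T w : ssyt T -> shape T = shape (ins w) ->
  exists v, [/\ ins v = T, size v = size w &
    forall k, shape (ins (take k v)) = shape (ins (take k w))].
Proof.
elim/last_ind: w T => [|w z IH] T sT.
  by case: T sT => // _ _; exists [::].
rewrite ins_rcons shape_insert => E.
have [x [T' [sT' E' EI]]] := tab_insert_surj sT (ssyt_ins w) E.
have [v [Ev sv H]] := IH T' sT' E'.
exists (rcons v x); split; first by rewrite ins_rcons Ev EI.
  by rewrite !size_rcons sv.
move=> k; case: (leqP k (size w)) => hk.
  by rewrite -!cats1 !takel_cat // sv.
by rewrite !take_oversize ?size_rcons ?sv // !ins_rcons !shape_insert Ev E' EI.
Qed.

Lemma perm_ins w : perm_eq (flatten (ins w)) w.
Proof.
have row x r : perm_eq (x :: r)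
    (let: (b, r') := row_insert x r in if b is Some y then y :: r' else r').
  elim: r x => //= y r IHr x; case: ltnP => _.
    by rewrite -(cat1s x) -(cat1s y) perm_catCA.
  have := IHr x; case: row_insert => [[z|] r'] /= H.
    rewrite -(cat1s x) -(cat1s y) perm_catCA /= perm_sym -(cat1s z) -(cat1s y).
    by rewrite perm_catCA /= perm_cons perm_sym.
  by rewrite -(cat1s x) -(cat1s y) perm_catCA /= perm_cons.
have tab x t : perm_eq (flatten (tab_insert x t).1) (x :: flatten t).
  elim: t x => //= r t IH x; have := row x r.
  case: row_insert => [[y|] r'] /= H.
    have := IH y; case: tab_insert => t' i /= H'.
    rewrite -cat_cons perm_sym (perm_trans (perm_cat H (perm_refl _))) //= perm_sym.
    by rewrite (perm_trans (perm_cat (perm_refl r') H')) // -cat1s perm_catCA.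
  by rewrite perm_sym -cat_cons perm_cat.
elim/last_ind: w => // w x IH; rewrite ins_rcons (perm_trans (tab _ _)) //.
by rewrite perm_sym perm_rcons perm_cons perm_sym.
Qed.

(** * Adding a largest letter *)

Lemma row_insert_rcons_max x r m : x < m -> all (gtn m) r ->
  row_insert x (rcons r m) =
    let: (b, r') := row_insert x r in
    if b is Some y then (Some y, rcons r' m) else (Some m, r').
Proof.
move=> xm; elim: r => /= [_|y r IH /andP[ym /IH ->]]; first by rewrite xm.
by case: ltnP => // _; case: row_insert => [[z|] r'].
Qed.

Lemma row_insert_le m x r : x < m -> all (gtn m) r ->
  forall y, (row_insert x r).1 = Some y -> y < m.
Proof.
move=> xm /allP hr y; rewrite row_insertE /= => /onth_SomeE[h ->].
by apply: hr; rewrite mem_nth.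
Qed.

Lemma tab_insert_max m t : all (all (gtn m)) t ->
  tab_insert m t = (tab_add t 0 m, 0).
Proof.
case: t => //= r t /andP[hr _].
by rewrite row_insert_last //; apply: sub_all hr => y /ltnW.
Qed.

(** The bumping path of [x] meets the largest letter [m] only if it would stop by appending to row
    [a]; then [m] is bumped and appended to the next row. *)
Lemma tab_insert_add m x t a : x < m -> all (all (gtn m)) t ->
  tab_insert x (tab_add t a m) =
    let: (t', b) := tab_insert x t in
    if b == a then (tab_add t' a.+1 m, a.+1) else (tab_add t' a m, b).
Proof.
elim: t x a => [|r t IH] x [|a] xm //=.
- by rewrite /tab_add /= xm.
- by case: a.
- case/andP=> hr ht; rewrite row_insert_rcons_max //.
  case: row_insert => [[y|] r'] /=; first by case: tab_insert.
  by rewrite tab_insert_max.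
case/andP=> hr ht; have := row_insert_le xm hr; rewrite -/(tab_add t a m).
case: row_insert => [[y|] r'] //= /(_ y erefl) ym.
rewrite IH //; case: tab_insert => t' b /=.
by rewrite eqSS; case: eqP.
Qed.

Lemma all_ins (p : pred nat) w : all (all p) (ins w) = all p w.
Proof. rewrite -(perm_all p (perm_ins w)).
by elim: (ins w) => //= r t ->; rewrite all_cat. Qed.

(** While [v] is inserted, [m] never influences the smaller letters; it only moves down a row at
    times. *)
Lemma ins_max_mid u m v : all (gtn m) u -> all (gtn m) v ->
  exists a, ins (u ++ m :: v) = tab_add (ins (u ++ v)) a m.
Proof.
move=> hu; elim/last_ind: v => [_|v x IH].
  exists 0; rewrite cats1 cats0 ins_rcons tab_insert_max //.
  by rewrite all_ins.
rewrite all_rcons => /andP[xm hv]; have [a E] := IH hv.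
rewrite -!rcons_cons -!rcons_cat !ins_rcons E tab_insert_add ?all_ins ?all_cat ?hu //.
case: tab_insert => t b /=.
by case: eqP => _ /=; [exists a.+1 | exists a].
Qed.

(** Left inverse of adding a largest letter [m]; empty rows are dropped because the added cell may
    have opened a new row. *)
Definition tab_lt m (t : seq (seq nat)) :=
  [seq r <- [seq filter (gtn m) r | r <- t] | r != [::]].

Lemma tab_addK m t a : all (all (gtn m)) t -> [::] \notin t ->
  tab_lt m (tab_add t a m) = t.
Proof.
have fm : filter (gtn m) [:: m] = [::] by rewrite /= ltnn.
elim: t a => [|r t IH] [|a] /=.
- by move=> _ _; rewrite /tab_lt /= ltnn.
- by move=> _ _; rewrite /tab_lt /=; elim: a => //=; rewrite ltnn.
- rewrite inE negb_or => /andP[hr ht] /andP[nr nt].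
  rewrite /tab_lt /= filter_rcons /= ltnn (all_filterP hr) eq_sym nr.
  congr (_ :: _); have {}ht := allP ht; elim: t nt ht {IH} => //= q t IH.
  rewrite inE negb_or => /andP[nq nt] ht.
  rewrite (all_filterP (ht q _)) ?mem_head // eq_sym nq IH // => z hz.
  by apply: ht; rewrite inE hz orbT.
rewrite inE negb_or => /andP[hr ht] /andP[nr nt].
rewrite /tab_lt /= (all_filterP hr) eq_sym nr; congr (_ :: _).
exact: IH.
Qed.

Lemma ins_nonempty w : [::] \notin ins w.
Proof.
by elim: (ins w) (ssyt_ins w) => //= r t IH [rn _ _ /IH]; rewrite inE negb_or eq_sym rn.
Qed.

(** * Growth diagrams and inversion *)

(** The points of the permutation matrix in a corner; the insertion shape labels the vertex [(i, j)]
    of the growth diagram. Letters start at 1, so the ordinal [j] stands for the letter [j.+1]. *)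
Definition subword n (s : 'S_n) i j := [seq x <- take i (one_line s) | x <= j].

Lemma size_one_line n (s : 'S_n) : size (one_line s) = n.
Proof. by rewrite size_map size_enum_ord. Qed.

Lemma nth_one_line n (s : 'S_n) (i : 'I_n) : nth 0 (one_line s) i = (s i).+1.
Proof. by rewrite (nth_map i) ?size_enum_ord // nth_ord_enum. Qed.

Lemma one_line_uniq n (s : 'S_n) : uniq (one_line s).
Proof.
rewrite map_inj_uniq ?enum_uniq // => i j [E].
by apply: (@perm_inj _ s); apply: val_inj.
Qed.

Lemma mem_one_line n (s : 'S_n) x : (x \in one_line s) = (0 < x <= n).
Proof.
apply/mapP/idP => [[i _ ->]|]; first by rewrite /= ltn_ord.
case: x => //= x hx; exists (s^-1 (Ordinal hx))%g; first by rewrite mem_enum.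
by rewrite permKV.
Qed.

Lemma mem_take_one_line n (s : 'S_n) (j : 'I_n) i :
  (j.+1 \in take i (one_line s)) = ((s^-1)%g j < i).
Proof.
rewrite in_take ?mem_one_line ?ltn_ord //.
have <- : nth 0 (one_line s) ((s^-1)%g j) = j.+1 by rewrite nth_one_line permKV.
by rewrite index_uniq ?one_line_uniq // size_one_line.
Qed.

Lemma subword_all n (s : 'S_n) i j : all (gtn j.+1) (subword s i j).
Proof. exact: filter_all. Qed.

Lemma subword_posS n (s : 'S_n) (i : 'I_n) j :
  subword s i.+1 j =
    if s i < j then rcons (subword s i j) (s i).+1 else subword s i j.
Proof.
rewrite /subword (take_nth 0) ?size_one_line // nth_one_line filter_rcons.
by [].
Qed.

Lemma subword_valS n (s : 'S_n) i (j : 'I_n) : (s^-1)%g j < i ->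
  exists u v, subword s i j.+1 = u ++ j.+1 :: v /\ subword s i j = u ++ v.
Proof.
rewrite -mem_take_one_line /subword => h.
have := take_uniq i (one_line_uniq s); case/splitPr: h => u v hu.
exists (filter (leq^~ j) u), (filter (leq^~ j) v).
rewrite !filter_cat /= leqnn ltnn; split=> //.
move: hu; rewrite cat_uniq /= negb_or => /and4P[_ /andP[hu _] hv _].
have E w : j.+1 \notin w -> filter (leq^~ j.+1) w = filter (leq^~ j) w.
  by move=> hw; apply: eq_in_filter => x; case: (eqVneq x j.+1) hw => [-> /negbTE->|]; lia.
by rewrite !E.
Qed.

Lemma subword_valS_notin n (s : 'S_n) i (j : 'I_n) :
  i <= (s^-1)%g j -> subword s i j.+1 = subword s i j.
Proof.
rewrite leqNgt -mem_take_one_line => h; apply: eq_in_filter => x.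
by case: (eqVneq x j.+1) h => [-> /negbTE->|]; lia.
Qed.

Lemma ins_subword_valS n (s : 'S_n) i (j : 'I_n) : (s^-1)%g j < i ->
  exists a, ins (subword s i j.+1) = tab_add (ins (subword s i j)) a j.+1.
Proof.
move=> h; have [u [v [-> E]]] := subword_valS h; rewrite E.
have := subword_all s i j; rewrite E all_cat => /andP[].
exact: ins_max_mid.
Qed.

(* Fomin's local rule. Passing from s to s^-1 exchanges i with j, hence a with b,
   and the last shape is symmetric in a and b. *)
Lemma local_rule n (s : 'S_n) (i j : 'I_n) (mu := shape (ins (subword s i j))) :
  s i < j -> (s^-1)%g j < i ->
  exists a b, [/\ shape (ins (subword s i j.+1)) = incr_nth mu a,
    shape (ins (subword s i.+1 j)) = incr_nth mu b &
    shape (ins (subword s i.+1 j.+1)) =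
      if a == b then incr_nth (incr_nth mu a) a.+1
      else incr_nth (incr_nth mu a) b].
Proof.
move=> sij sji; have [a Ea] := ins_subword_valS sji.
exists a, (tab_insert (s i).+1 (ins (subword s i j))).2.
rewrite !subword_posS sij ltnS (ltnW sij) !ins_rcons Ea; split.
- exact: shape_tab_add.
- exact: shape_insert.
rewrite tab_insert_add ?all_ins ?subword_all //.
have := shape_insert (s i).+1 (ins (subword s i j)); rewrite -/mu.
case: tab_insert => t b /= Et; rewrite eq_sym.
by case: eqP => [->|_] /=; rewrite shape_tab_add Et // incr_nthC.
Qed.

Lemma subword0 n (s : 'S_n) i : subword s i 0 = [::].
Proof.
apply/eqP; rewrite -[_ == _]negbK -has_filter -all_predC; apply/allP => x.
by move=> /mem_take; rewrite mem_one_line => /andP[x0 _]; rewrite /= -ltnNge.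
Qed.

(** Induction over the cells of the growth diagram: the shape at the far corner follows from the
    other three, by cases that inversion preserves or exchanges. *)
Lemma growth_sym n (s : 'S_n) i j : i <= n -> j <= n ->
  shape (ins (subword s i j)) = shape (ins (subword s^-1 j i)).
Proof.
have W0 := @subword0 n.
have W0' (t : 'S_n) k : subword t 0 k = [::] by rewrite /subword take0.
elim: i j => [|i IHi] j; first by rewrite W0 W0'.
move=> hi; elim: j => [|j IHj] hj; first by rewrite W0 W0'.
have {}IHj := IHj (ltnW hj).
have IHd := IHi j (ltnW hi) (ltnW hj); have {}IHi := IHi j.+1 (ltnW hi) hj.
pose I := Ordinal hi; pose J := Ordinal hj.
case: (ltngtP (s I) J) => sIJ; last first.
(* The cell contains a point: the new letter is both last and largest, so it ends the first row. *)
- have sJI : (s^-1)%g J = I by rewrite -(val_inj sIJ) permK.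
  have Emax (t : 'S_n) (a b : 'I_n) : t a = b -> (t^-1)%g b = a ->
      shape (ins (subword t a.+1 b.+1)) = incr_nth (shape (ins (subword t a b))) 0.
    move=> tab tba; rewrite subword_posS tab ltnSn subword_valS_notin ?tba //.
    rewrite ins_rcons tab_insert_max ?all_ins ?subword_all //.
    exact: shape_tab_add.
  rewrite (Emax s I J (val_inj sIJ) sJI) (Emax s^-1 J I)%g ?invgK ?IHd //.
  exact: val_inj.
(* The letter at the new position exceeds the value bound, so the shape is that at [(i, j.+1)]. *)
- rewrite (subword_posS s I) ltnS leqNgt sIJ /= IHi.
  by rewrite (@subword_valS_notin _ s^-1 j.+1 I)%g // invgK.
case: (ltnP ((s^-1)%g J) I) => sJI.
  (* Both points precede the cell; the rule for [s^-1] has [a] and [b] exchanged. *)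
  have [a [b [E1 E2 ->]]] := local_rule sIJ sJI.
  have [|a' [b' [E1' E2' ->]]] := @local_rule _ (s^-1)%g J I sJI.
    by rewrite invgK.
  move: E1' E2'; rewrite -[subword _ J I.+1]/(subword s^-1 j i.+1)%g -IHj E2.
  rewrite -[subword _ J.+1 I]/(subword s^-1 j.+1 i)%g -IHi E1.
  rewrite -[subword _ J I]/(subword s^-1 j i)%g -IHd.
  move=> /incr_nth_inj -> /incr_nth_inj <-; rewrite eq_sym.
  by case: eqP => [->|_] //; rewrite incr_nthC.
(* The letter [j.+1] occurs only at a later position, so the shape is that at [(i.+1, j)]. *)
have nJI : I != (s^-1)%g J by apply: contraTneq sIJ => ->; rewrite permKV ltnn.
have {nJI} sJI : I < (s^-1)%g J by rewrite ltn_neqAle nJI.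
rewrite (@subword_valS_notin _ s i.+1 J) // IHj.
by rewrite (subword_posS s^-1 J)%g ifF // ltnS leqNgt sJI.
Qed.

Lemma subword_pos n (s : 'S_n) i : subword s i n = take i (one_line s).
Proof.
by apply/all_filterP/allP => x /mem_take; rewrite mem_one_line => /andP[].
Qed.

Lemma subword_full n (s : 'S_n) : subword s n n = one_line s.
Proof. by rewrite subword_pos take_oversize ?size_one_line. Qed.

Lemma shape_ins_inv n (s : 'S_n) :
  shape (ins (one_line s^-1)%g) = shape (ins (one_line s)).
Proof. by rewrite -!subword_full growth_sym ?invgK. Qed.

(** A tableau amounts to the chain of shapes of its parts with entries up to [j]. Dropping the
    letters above [j] from the word yields that part, as a largest letter only adds a cell. *)
Lemma ins_one_line_eqP n (s t : 'S_n) :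
  ins (one_line s) = ins (one_line t) <->
  forall j, j <= n -> shape (ins (subword s n j)) = shape (ins (subword t n j)).
Proof.
split=> [E j hj|H].
  congr shape; rewrite -(subKn hj).
  elim: (n - j) (leq_subr j n) => [|k IH] hk; first by rewrite subn0 !subword_full.
  have {}IH := IH (ltnW hk); have hK : n - k.+1 < n by lia.
  have step (u : 'S_n) : tab_lt (n - k.+1).+1 (ins (subword u n (n - k))) =
      ins (subword u n (n - k.+1)).
    have [a] := @ins_subword_valS _ u n (Ordinal hK) (ltn_ord _).
    have -> : n - k = (Ordinal hK).+1 by rewrite /=; lia.
    by move=> ->; rewrite tab_addK ?ins_nonempty ?all_ins ?subword_all.
  by rewrite -!step IH.
suff main j : j <= n -> ins (subword s n j) = ins (subword t n j).
  by rewrite -!subword_full main.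
elim: j => [|j IH] hj; first by rewrite !subword0.
have [a Ea] := @ins_subword_valS _ s n (Ordinal hj) (ltn_ord _).
have [b Eb] := @ins_subword_valS _ t n (Ordinal hj) (ltn_ord _).
have := H j.+1 hj; rewrite Ea Eb !shape_tab_add /= IH; last exact: ltnW.
by move=> /incr_nth_inj ->.
Qed.

(** * Longest increasing subsequences *)

(** The invariant of patience sorting: entry [k] of the first row is the least last letter of a
    weakly increasing subsequence of length [k.+1]. *)
Lemma first_row_invariant w (r := head [::] (ins w)) :
  (forall k, k < size r -> exists v,
     [/\ subseq v w, sorted leq v, size v = k.+1 & last 0 v = nth 0 r k]) /\
  (forall v, subseq v w -> sorted leq v -> v != [::] ->
     (size v <= size r) && (nth 0 r (size v).-1 <= last 0 v)).
Proof.
rewrite {}/r; elim/last_ind: w => [|w x].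
  by split=> // v; rewrite subseq0 => /eqP->.
have := ssyt_ins w; rewrite ins_rcons head_tab_insert.
set r := head _ _ => sw.
have sr : sorted leq r by rewrite /r; case: (ins w) sw => //= ? ? [].
rewrite row_insertE /=; set p := find _ r => -[IH1 IH2].
have pr : p <= size r by exact: find_size.
have before k : k < p -> nth 0 r k <= x.
  by move=> kp; have /negbT := before_find 0 kp; rewrite /= -leqNgt.
have after k : p <= k -> k < size r -> x < nth 0 r k.
  move=> pk kr; apply: leq_trans (sorted_leq_nth0 sr pk kr).
  by apply: (nth_find 0 (a := ltn x)); rewrite has_find -/p; lia.
split=> [k | v].
  rewrite size_set_nth nth_set_nth /= => hk.
  case: eqVneq => [->|nk]; last first.
    have [v [h1 h2 h3 h4]] := IH1 k ltac:(lia); exists v; split=> //.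
    exact: subseq_trans h1 (subseq_rcons _ _).
  case: (posnP p) => [->|p0].
    by exists [:: x]; split=> //; rewrite sub1seq mem_rcons mem_head.
  (* The entry left of position [p] is at most [x], so a subsequence ending in it extends by [x]. *)
  have [v [h1 h2 h3 h4]] := IH1 p.-1 ltac:(lia).
  exists (rcons v x); split.
  - by rewrite -!cats1 cat_subseq.
  - case: v h2 h3 h4 {h1} => //= a v h2 _ h4.
    by rewrite rcons_path h2 h4 before //; lia.
  - by rewrite size_rcons h3 prednK.
  - by rewrite last_rcons.
rewrite size_set_nth nth_set_nth /=.
(* Subsequences of [w] keep their bounds: the one changed entry has decreased or is new. *)
have old (u : seq nat) : subseq u w -> sorted leq u -> u != [::] ->
    (size u <= maxn p.+1 (size r)) &&
    ((if (size u).-1 == p then x else nth 0 r (size u).-1) <= last 0 u).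
  move=> uw su un; have /andP[h1 h2] := IH2 u uw su un.
  have u0 : 0 < size u by rewrite lt0n size_eq0.
  apply/andP; split; first lia.
  case: eqP => // E; apply: leq_trans h2; apply/ltnW; rewrite E; apply: after; lia.
case/lastP: v => // v y; rewrite -[rcons w x]cats1 => vw sv vn.
have [Eyx|nyx] := eqVneq y x; last first.
  apply: old => //; move: vw; rewrite cats1.
  by rewrite -subseq_rev !rev_rcons /= (negbTE nyx) -rev_rcons subseq_rev.
rewrite {}Eyx in vw sv vn *.
have {}vw : subseq v w.
  by move: vw; rewrite cats1 -subseq_rev !rev_rcons /= eqxx subseq_rev.
rewrite size_rcons last_rcons /=.
have [->|vn'] := eqVneq v [::].
  apply/andP; split=> /=; first lia.
  by case: eqVneq => // np; apply: before; lia.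
have sv' : sorted leq v.
  by move: sv; case: (v) => //= a u; rewrite rcons_path => /andP[].
have lvx : last 0 v <= x.
  by move: sv; case: (v) vn' => //= a u _; rewrite rcons_path => /andP[].
have /andP[h1 h2] := IH2 v vw sv' vn'.
have v0 : 0 < size v by rewrite lt0n size_eq0.
(* This entry is at most [last 0 v <= x], so it lies left of [p]; appending [x] then needs at most
   [p.+1] columns. *)
have vp : (size v).-1 < p.
  by rewrite ltnNge; apply/negP => pv; have := after _ pv ltac:(lia); lia.
apply/andP; split; first lia.
by case: eqVneq => // np; apply: before; lia.
Qed.

(** For distinct letters, weakly increasing subsequences are strictly increasing; the two halves of
    the invariant give the two inequalities. *)
Lemma schensted w : uniq w -> lis w = head 0 (shape (ins w)).
Proof.
move=> uw; rewrite -size_head; have [H1 H2] := first_row_invariant w.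
apply/eqP; rewrite eqn_leq; apply/andP; split.
  apply/bigmax_leqP => m; rewrite ltn_sorted_uniq_leq => /andP[_ sm].
  have [->//|n0] := eqVneq (mask m w) [::].
  by have /andP[] := H2 _ (mask_subseq m w) sm n0.
case E: (size _) => [//|k].
have [v [/subseqP[m sm Ev] sv <- _]] := H1 k ltac:(by rewrite E).
have hm : size m == size w by apply/eqP.
rewrite Ev; apply: (leq_bigmax_cond (Tuple hm)) => /=.
by rewrite -Ev ltn_sorted_uniq_leq sv andbT Ev mask_uniq.
Qed.

Lemma lis_one_line n (s : 'S_n) : lis (one_line s) = head 0 (sh s).
Proof. by rewrite schensted ?one_line_uniq // /sh RS_ins. Qed.

(** * Permutations of a given shape *)

Lemma one_line_surj n w : perm_eq w (iota 1 n) -> exists s : 'S_n, one_line s = w.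
Proof.
move=> pw; have sw : size w = n by rewrite (perm_size pw) size_iota.
have uw : uniq w by rewrite (perm_uniq pw) iota_uniq.
have nz (i : 'I_n) : 0 < nth 0 w i <= n.
  have : nth 0 w i \in w by rewrite mem_nth ?sw.
  by rewrite (perm_mem pw) mem_iota.
have lt (i : 'I_n) : (nth 0 w i).-1 < n by have := nz i; lia.
have inj : injective (fun i => Ordinal (lt i)).
  move=> i j [E]; apply/val_inj/eqP.
  have Eij : nth 0 w i = nth 0 w j by have := nz i; have := nz j; lia.
  by rewrite -(nth_uniq 0 _ _ uw) ?sw ?ltn_ord // Eij.
exists (perm inj); apply: (@eq_from_nth _ 0); rewrite size_one_line ?sw // => i hi.
by rewrite (nth_one_line _ (Ordinal hi)) permE /= prednK //; have /andP[] := nz (Ordinal hi).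
Qed.

Lemma perm_one_line n (s : 'S_n) : perm_eq (one_line s) (iota 1 n).
Proof.
apply: uniq_perm; rewrite ?one_line_uniq ?iota_uniq // => x.
by rewrite mem_one_line mem_iota.
Qed.

(** The insertion tableau of the inverse acts as the recording tableau: growth symmetry turns its
    value-bounded shapes into prefix shapes of the permutation. *)
Lemma ins_inv_eqP n (s t : 'S_n) :
  ins (one_line s^-1)%g = ins (one_line t^-1)%g <->
  forall i, i <= n ->
    shape (ins (take i (one_line s))) = shape (ins (take i (one_line t))).
Proof.
rewrite ins_one_line_eqP; split=> H i hi; have := H i hi.
  by rewrite -!(growth_sym _ hi) // !subword_pos.
by rewrite -!subword_pos !(growth_sym _ hi).
Qed.

Lemma ins_perm_inj n (s t : 'S_n) : ins (one_line s) = ins (one_line t) ->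
  ins (one_line s^-1)%g = ins (one_line t^-1)%g -> s = t.
Proof.
move=> E /ins_inv_eqP H; have Es : one_line s = one_line t.
  by apply: ins_inj; rewrite ?size_one_line.
apply/permP => i; apply: val_inj; apply: succn_inj.
by rewrite -!nth_one_line Es.
Qed.

(** [s] supplies the insertion tableau and [t] the prefix shapes. The resulting word is a
    permutation because it has the letters of its tableau. *)
Lemma ins_perm_surj n (s t : 'S_n) : sh s = sh t ->
  exists u : 'S_n, ins (one_line u) = ins (one_line s) /\
    ins (one_line u^-1)%g = ins (one_line t^-1)%g.
Proof.
rewrite /sh !RS_ins => E.
have [v [Ev _ Hv]] := ins_surj (ssyt_ins _) E.
have [|u Eu] := @one_line_surj n v.
  rewrite (perm_trans _ (perm_one_line s)) //.
  by rewrite -(permPr (perm_ins _)) -Ev perm_sym perm_ins.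
exists u; rewrite Eu; split=> //.
by apply/ins_inv_eqP => i _; rewrite Eu.
Qed.

(** Involutions stand in for tableaux: each insertion tableau belongs to exactly one. The bijection
    sends [s] to the involutions with the tableaux of [s] and of [s^-1]. *)
Lemma card_sh n (la : seq nat) :
  #|[set s : 'S_n | sh s == la]| =
  #|[set s : 'S_n | (s * s == 1)%g && (sh s == la)]| ^ 2.
Proof.
set X := [set s | _]; set I := [set s | _].
pose P (s : 'S_n) := ins (one_line s).
have shP (s : 'S_n) : sh s = shape (P s) by rewrite /sh RS_ins.
have invE (s : 'S_n) : (s * s == 1)%g = (s^-1 == s)%g by rewrite -eq_invg_mul.
(* Both tableaux of [u] are chosen equal to [P s]; then [u] and [u^-1] have the same pair and
   coincide. *)
have exI s : exists u : 'S_n, (P u == P s) && (u * u == 1)%g.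
  have [|u [E1 E2]] := @ins_perm_surj _ s s^-1%g.
    by rewrite !shP /P shape_ins_inv.
  exists u; rewrite /P E1 eqxx invE; apply/eqP; apply: ins_perm_inj.
    by rewrite E2 invgK.
  by rewrite invgK E1 E2 invgK.
pose g s := xchoose (exI s).
have gP s : P (g s) = P s /\ ((g s)^-1 = g s)%g.
  have /andP[/eqP E h] := xchooseP (exI s); split=> //.
  by apply/eqP; rewrite -invE.
have gI s : sh s = la -> g s \in I.
  by rewrite inE => <-; rewrite !shP (gP s).1 invE (gP s).2 !eqxx.
have f_inj : {in X &, injective (fun s => (g s, g s^-1%g))}.
  move=> s t _ _ [E1 E2]; apply: ins_perm_inj; rewrite -!/(P _).
    by rewrite -(gP s).1 E1 (gP t).1.
  by rewrite -(gP s^-1%g).1 E2 (gP t^-1%g).1.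
rewrite -(card_in_imset f_inj) expnS expn1 -cardsX; apply/eq_card => -[s t].
rewrite in_setX; apply/imsetP/andP => [[u]|[]].
  rewrite inE => /eqP hu [-> ->]; split; apply: gI => //.
  by rewrite shP /P shape_ins_inv -/(P u) -shP.
rewrite !inE !invE => /andP[/eqP Is /eqP hs] /andP[/eqP It /eqP ht].
have [|u [E1 E2]] := @ins_perm_surj _ s t; first by rewrite hs ht.
(* An involution is determined by its insertion tableau. *)
have gE v w : (w^-1)%g = w -> P v = P w -> g v = w.
  move=> Iw E; apply: ins_perm_inj; rewrite -!/(P _) ?(gP v).2 ?Iw.
    by rewrite (gP v).1.
  by rewrite (gP v).1.
exists u; first by rewrite inE shP /P E1 -/(P s) -shP hs.
by rewrite (gE u s) // (gE u^-1 t)%g // -[P t](congr1 P It).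
Qed.

(** * Counts and log concavity *)

Lemma ell_invol n (Lambda : {pred seq nat}) k :
  {in Lambda &, forall la mu, head 0 la = k -> head 0 mu = k -> la = mu} ->
  ell n Lambda k = invol n Lambda k ^ 2.
Proof.
move=> hrow; rewrite /ell /invol.
(* If some permutation is counted, its shape is the only one possible; otherwise both counts
   vanish. *)
have [s0 /andP[/eqP h0 L0] | no] := pickP (fun s : 'S_n =>
  (lis (one_line s) == k) && (sh s \in Lambda)); last first.
  rewrite !eq_card0 // => s; rewrite !inE; first by rewrite no andbF.
  by rewrite no.
rewrite lis_one_line in h0.
have E s : (lis (one_line s) == k) && (sh s \in Lambda) = (sh s == sh s0).
  rewrite lis_one_line; apply/andP/eqP => [[/eqP h L]|->]; last by rewrite h0 eqxx.
  exact: hrow.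
have := card_sh n (sh s0).
rewrite -(eq_card
  (A := [set s : 'S_n | (lis (one_line s) == k) && (sh s \in Lambda)])); last first.
  by move=> s; rewrite !inE E.
move=> ->; congr (_ ^ 2); apply: eq_card => s; rewrite !inE.
by rewrite -E.
Qed.

Local Open Scope ring_scope.

Theorem lemma2p3 (R : realFieldType) (n : nat) (Lambda : {pred seq nat})
  (hn : (1 <= n)%N)
  (hpart : {subset Lambda <= intpartn n})
  (hrow : forall k : nat, (1 <= k <= n)%N ->
     forall la mu : seq nat, la \in Lambda -> mu \in Lambda ->
       head 0%N la = k -> head 0%N mu = k -> la = mu) :
  log_concave n (fun k => (ell n Lambda k)%:R : R) <->
  log_concave n (fun k => (invol n Lambda k)%:R : R).
Proof.
pose i k : R := pad0 n (fun k => (invol n Lambda k)%:R) k.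
have i0 k : 0 <= i k by rewrite /i /pad0; case: ifP.
(* The padding zeros are squares too; inside the range, [hk] makes [hrow] applicable. *)
have E k : pad0 n (fun k => (ell n Lambda k)%:R : R) k = i k ^+ 2.
  rewrite /i /pad0; case: ifP => [hk|_]; last by rewrite expr0n.
  by rewrite ell_invol ?natrX // => la mu hl hm; apply: hrow hl hm.
(* The inequality for [ell] is that for [invol] with both nonnegative sides squared. *)
split=> H k hk; have := H k hk; rewrite !E -/(i _) -/(i k) -exprMn;
  by rewrite ler_pXn2r // nnegrE ?mulr_ge0 ?exprn_ge0.
Qed.
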